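(* Assume that there exist functions $m_1,m_2:S\to[2,+\infty)$ and $\varphi_1,\varphi_2,\psi_1,\psi_2:S\to(0,+\infty)$ such that $$\psi_1(x)+\varphi_1(x)t^{m_1(x)-1}\le f(x,t)\le \varphi_2(x)t^{m_2(x)-1}+\psi_2(x)\quad\text{for all }x\in S,\ t\ge 0,$$ and let $p^-\neq m_1^+$. Put $$\lambda_2:=\frac{\frac{q^-}{p^+}\,2^{-\frac{p^+}{2}}|\partial S|^{\frac{p^+}{2}}|\overline S|^{1-p^+}|\overline S|^{-\frac{p^+}{2}}}{\left(\frac{\varphi_2^+}{m_2^-}|\overline S|^{-\frac{m_2^-}{2}}+\psi_2^+\right)|S|}.$$ Then for every $\lambda\in(0,\lambda_2)$ the problem $$\begin{cases}-\Delta_{p(x),\omega}u(x)+q(x)|u(x)|^{p(x)-2}u(x)=\lambda f(x,u(x)), & x\in S,\\ u(x)=0, & x\in\partial S,\end{cases}$$ has at least one positive solution.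
   Context: Let $\overline S=(S\cup\partial S,V)$ be a simple, connected, undirected, weighted graph whose vertex set is the union of two finite, disjoint, nonempty sets $S$ (interior) and $\partial S$ (boundary), and whose edge set is $V$, a set of unordered pairs of distinct vertices. The symbol $\overline S$ also denotes the vertex set $S\cup\partial S$; $|\cdot|$ of a set is its cardinality. The weight is a function $\omega:\overline S\times\overline S\to[0,+\infty)$ with $\omega(x,y)=\omega(y,x)$ if $\{x,y\}\in V$, and $\omega(x,y)=0$ if and only if $\{x,y\}\notin V$. The functions $q:S\to(0,+\infty)$ and $p:\overline S\to[2,+\infty)$ are given, and $f:S\times\mathbb R\to\mathbb R$ is such that $f(x,\cdot)$ is continuous for each $x\in S$. The discrete $p(\cdot)$-Laplacian of $u:\overline S\to\mathbb R$ is $$\Delta_{p(x),\omega}u(x)=\sum_{y\in\overline S}|u(y)-u(x)|^{p(x)-2}(u(y)-u(x))\,\omega(x,y),\quad x\in\overline S.$$ A positive solution is a function $u:\overline S\to\mathbb R$ satisfying the equation on $S$, the boundary condition $u=0$ on $\partial S$, and $u(x)>0$ for all $x\in S$. Notation: $p^-=\min_{S}p$, $p^+=\max_{S}p$, $q^-=\min_S q$, $m_1^+=\max_S m_1$, $m_2^-=\min_S m_2$, $\varphi_2^+=\max_S\varphi_2$, $\psi_2^+=\max_S\psi_2$ (all extrema over the interior $S$). *)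

(* Defs.v *)
From HB Require Import structures.
From mathcomp Require Import all_boot all_order all_algebra.
From mathcomp Require Import all_classical all_reals all_analysis.
Set Implicit Arguments.
Unset Strict Implicit.
Unset Printing Implicit Defensive.
Import Order.TTheory GRing.Theory Num.Theory.
Import numFieldNormedType.Exports.
Local Open Scope ring_scope.

(* The carrier [T] is the whole vertex set S u dS; [edge x y] means that {x, y}
   is an edge. A function with domain S is represented by a function on [T]
   whose values outside S are never used. *)
Record weighted_graph (R : realType) (T : finType) (S dS : {set T})
    (edge : rel T) (w : T -> T -> R) : Prop := WeightedGraph {
  interior_gt0 : (0 < #|S|)%N;
  boundary_gt0 : (0 < #|dS|)%N;
  interior_boundary_disjoint : [disjoint S & dS];
  interior_boundary_cover : forall x : T, x \in S :|: dS;
  edge_symmetric : symmetric edge;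
  edge_irreflexive : irreflexive edge;
  edge_connected : forall x y : T, connect edge x y;
  weight_ge0 : forall x y : T, 0 <= w x y;
  weight_symmetric : forall x y : T, edge x y -> w x y = w y x;
  weight_eq0 : forall x y : T, w x y = 0 <-> ~~ edge x y }.

(* Minimum and maximum of [g] over [S]; the value 0 for empty [S] is junk. *)
Definition min_on (R : realType) (T : finType) (S : {set T}) (g : T -> R) : R :=
  if [pick x in S] is Some x0 then g [arg min_(x < x0 in S) g x]%O else 0.

Definition max_on (R : realType) (T : finType) (S : {set T}) (g : T -> R) : R :=
  if [pick x in S] is Some x0 then g [arg max_(x > x0 in S) g x]%O else 0.

(* For p x = 2 and u y = u x, the convention 0 `^ 0 = 1 of [powR] is harmless
   because of the factor u y - u x. *)
Definition p_laplacian (R : realType) (T : finType) (w : T -> T -> R)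
    (p u : T -> R) (x : T) : R :=
  \sum_(y : T) `|u y - u x| `^ (p x - 2) * (u y - u x) * w x y.

Definition is_solution (R : realType) (T : finType) (S dS : {set T})
    (w : T -> T -> R) (p q : T -> R) (f : T -> R -> R) (lambda : R)
    (u : T -> R) : Prop :=
  (forall x, x \in S ->
     - p_laplacian w p u x + q x * `|u x| `^ (p x - 2) * u x
       = lambda * f x (u x))
  /\ (forall x, x \in dS -> u x = 0).

Definition is_positive_solution (R : realType) (T : finType) (S dS : {set T})
    (w : T -> T -> R) (p q : T -> R) (f : T -> R -> R) (lambda : R)
    (u : T -> R) : Prop :=
  is_solution S dS w p q f lambda u /\ (forall x, x \in S -> 0 < u x).

Definition lambda2 (R : realType) (T : finType) (S dS : {set T})
    (p q m2 phi2 psi2 : T -> R) : R :=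
  let pmax := max_on S p in
  let m2min := min_on S m2 in
  let cT : R := #|T|%:R in
  (min_on S q / pmax * 2 `^ (- (pmax / 2)) * #|dS|%:R `^ (pmax / 2)
     * cT `^ (1 - pmax) * cT `^ (- (pmax / 2)))
  / ((max_on S phi2 / m2min * cT `^ (- (m2min / 2)) + max_on S psi2)
     * #|S|%:R).

(* Main.v *)
(* The operator need not be variational, because [p x] differs from [p y] on an
   edge; instead one compares sub- and supersolutions. The residual of the
   equation at [x] is nonincreasing in the values [u y], [y <> x], and it is
   negative where a nonnegative [u] vanishes, since [f x 0 > 0]. For [lambda]
   below [lambda2], the function equal to the constant [|T|^(-1/2) / 2] on [S]
   and to [0] on [dS] is a supersolution, and the pointwise infimum of all
   nonnegative supersolutions is then a positive solution. *)
Require Import Defs.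
From HB Require Import structures.
From mathcomp Require Import all_boot all_order all_algebra.
From mathcomp Require Import all_classical all_reals all_analysis.
From mathcomp Require Import ring lra.
Set Implicit Arguments.
Unset Strict Implicit.
Unset Printing Implicit Defensive.
Import Order.TTheory GRing.Theory Num.Theory.
Import numFieldNormedType.Exports.
Local Open Scope ring_scope.

Lemma min_on_le (R : realType) (T : finType) (S : {set T}) (g : T -> R) x :
  x \in S -> min_on S g <= g x.
Proof.
rewrite /min_on => xS; case: pickP => [x0 x0S|/(_ x)]; last by rewrite /= xS.
by case: arg_minP => // i _; exact.
Qed.

Lemma max_on_ge (R : realType) (T : finType) (S : {set T}) (g : T -> R) x :
  x \in S -> g x <= max_on S g.
Proof.
rewrite /max_on => xS; case: pickP => [x0 x0S|/(_ x)]; last by rewrite /= xS.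
by case: arg_maxP => // i _; exact.
Qed.

Lemma min_on_attained (R : realType) (T : finType) (S : {set T}) (g : T -> R) :
  (0 < #|S|)%N -> exists2 x, x \in S & min_on S g = g x.
Proof.
case/card_gt0P => x xS; rewrite /min_on.
case: pickP => [x0 x0S|/(_ x)]; last by rewrite /= xS.
by case: arg_minP => // i iS _; exists i.
Qed.

(** With [a = p x - 2] this is the nonlinearity of the equation. Away from 0 the power is
    differentiable; at 0 the bound by [|s|] for [|s| <= 1] replaces differentiability. *)
Lemma signed_powR_continuous (R : realType) (a : R) : 0 <= a ->
  continuous (fun t : R => `|t| `^ a * t).
Proof.
move=> a0 t; have [->|t0] := eqVneq t 0.
  rewrite /continuous_at; apply/cvgrPdist_le => e e0; near=> s.
  rewrite mulr0 sub0r normrN normrM norm_powR // normr_id.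
  apply: (@le_trans _ _ `|s|); last by near: s; exact: (@nbhs0_le R R e e0).
  rewrite ler_piMl //.
  (* The case [s = 0] is separate: there the power is 1 or 0 according to whether [a = 0], hence at
     most 1. *)
  rewrite -[leRHS](powRr0 `|s|); have [->|s0] := eqVneq s 0.
    by rewrite normr0 powRr0 /powR eqxx lern1 leq_b1.
  apply: ger_powR => //; rewrite normr_gt0 s0 /=.
  by near: s; exact: (@nbhs0_le R R 1).
apply: (@cvgM R R (nbhs t) _ (fun s => `|s| `^ a) idfun); last exact: cvg_id.
apply: (@continuous_comp _ _ _ (fun s : R => `|s|) (fun s => s `^ a)).
  exact: norm_continuous.
apply: differentiable_continuous; apply/derivable1_diffP.
by apply: derivable_powR; rewrite in_itv /= andbT normr_gt0 t0.
Unshelve. all: by end_near.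
Qed.

(** Both factors grow on the nonnegative half-line, and oddness handles the negative one. This makes
    the residual at a vertex antitone in the values at the others. *)
Lemma signed_powR_nondecreasing (R : realType) (a : R) : 0 <= a ->
  {homo (fun t : R => `|t| `^ a * t) : s t / s <= t}.
Proof.
move=> a0 s t st; have [s0|s0] := leP 0 s.
  apply: ler_pM => //.
  by apply: ge0_ler_powR; rewrite ?nnegrE // !ger0_norm // (le_trans s0).
have [t0|t0] := leP 0 t.
  rewrite (@le_trans _ _ 0) ?mulr_ge0 ?powR_ge0 //.
  by rewrite mulr_ge0_le0 ?powR_ge0 // ltW.
rewrite -lerN2 -!mulrN.
apply: ler_pM; rewrite ?powR_ge0 ?oppr_ge0 ?lerN2 ?(ltW t0) //.
by apply: ge0_ler_powR; rewrite ?nnegrE // !ltr0_norm // lerN2.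
Qed.

(* The solution is the pointwise infimum of the nonnegative supersolutions:
   since [F x] is antitone in the values off [x], lowering a supersolution at a
   single vertex spoils the inequality at no other vertex. *)
Lemma Zsystem_solution (R : realType) (T : finType) (S : {set T})
    (F : T -> (T -> R) -> R) (c : R) :
  (forall x u v, x \in S -> (forall y, u y <= v y) -> u x = v x ->
     F x v <= F x u) ->
  (forall x u, x \in S ->
     continuous (fun t => F x (fun y => if y == x then t else u y))) ->
  (forall x u, x \in S -> (forall y, 0 <= u y) -> u x = 0 -> F x u < 0) ->
  0 <= c ->
  (forall x, x \in S -> 0 <= F x (fun y => if y \in S then c else 0)) ->
  exists u, [/\ forall x, x \in S -> F x u = 0,
                forall x, x \in S -> 0 < u x &
                forall x, x \notin S -> u x = 0].
Proof.
move=> Fanti Fcont Fsub c0 Fsup.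
pose K (u : T -> R) := [/\ forall x, 0 <= u x,
  forall x, x \notin S -> u x = 0 & forall x, x \in S -> 0 <= F x u].
pose E x : set R := [set u x | u in [set u | K u]]%classic.
have KcS : K (fun y => if y \in S then c else 0).
  by split=> [x|x /negbTE ->|]//; case: ifP.
have lbE x : lbound (E x) 0 by move=> _ [u [+ _ _] <-].
have E0 x : (E x !=set0)%classic by eexists; eexists; [exact: KcS|].
have hlE x : has_lbound (E x) by exists 0.
pose m x := inf (E x).
have mle u x : K u -> m x <= u x by move=> Ku; apply: ge_inf => //; exists u.
have m0 x : 0 <= m x by apply: lb_le_inf.
have mK : K m.
  split=> // [x xS|x xS].
    by apply/eqP; rewrite eq_le m0 andbT (le_trans (mle _ x KcS)) // (negbTE xS).
  have mE : m = fun y => if y == x then m x else m y.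
    by apply/funext => y; case: eqP => [->|].
  (* If [F x m < 0], then by continuity the sign persists when [m x] is raised to [v x] for some [v]
     in [K] with [v x] close to [m x]. The modified function lies below [v] and agrees with it at
     [x], so antitonicity gives [F x v < 0], a contradiction. *)
  rewrite leNgt; apply/negP => Fm0.
  have /cvgr_lt /(_ 0) := Fcont x m xS (m x).
  rewrite /= -mE => /(_ Fm0) /nbhs_ballP[e /= e0 he].
  have [_ [v Kv <-] vlt] := inf_adherent e0 (conj (E0 x) (hlE x)).
  have mv := mle _ x Kv.
  have: F x (fun y => if y == x then v x else m y) < 0.
    apply: he; rewrite /ball /= distrC ger0_norm ?subr_ge0 //.
    by rewrite ltrBlDl.
  rewrite ltNge => /negP; apply; have [_ _ Fv] := Kv.
  apply: (le_trans (Fv x xS)); apply: Fanti => // [y|]; last by rewrite eqxx.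
  by case: eqP => [->|_] //; exact: mle.
have [_ mS Fm] := mK; have mgt x : x \in S -> 0 < m x.
  move=> xS; rewrite lt_neqAle m0 andbT eq_sym; apply/eqP => mx0.
  by have := Fm x xS; rewrite leNgt Fsub.
exists m; split=> // x xS; apply/eqP; rewrite eq_le Fm // andbT leNgt.
apply/negP => Fmx.
have mE : m = fun y => if y == x then m x else m y.
  by apply/funext => y; case: eqP => [->|].
have /cvgr_gt /(_ 0) := Fcont x m xS (m x).
rewrite /= -mE => /(_ Fmx) /nbhs_ballP[e /= e0 he].
(* The minimum keeps [t] nonnegative and strictly inside the ball where the residual at [x] stays
   positive; lowering [m x] to [t] then yields an element of [K] below the infimum. *)
pose t := m x - Num.min (m x) (e / 2).
have mx0 := mgt x xS.
have d0 : 0 < Num.min (m x) (e / 2) by rewrite lt_min mx0 divr_gt0.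
have tm : t < m x by rewrite ltrBlDr ltrDl.
have t0 : 0 <= t by rewrite subr_ge0 ge_min lexx.
have Ft : 0 < F x (fun y => if y == x then t else m y).
  apply: he; rewrite /ball /= opprB addrCA subrr addr0 gtr0_norm //.
  by rewrite gt_min orbC ltr_pdivrMr // ltr_pMr // ltrDl ltr01.
suff /(mle _ x) : K (fun y => if y == x then t else m y).
  by rewrite eqxx leNgt tm.
split=> [y|y yS|y yS]; first by case: ifP.
- by case: eqP => [yx|_]; [rewrite -yx (negbTE yS) in xS|exact: mS].
- have [->|yx] := eqVneq y x; first exact: ltW.
  apply: (le_trans (Fm y yS)); apply: Fanti => // [z|].
    by case: eqP => [->|_] //; exact: ltW.
  by rewrite (negbTE yx).
Qed.

(** Since [exp (1/2) <= 2], the power [2^(m-2)] is at least [exp ((m-2)/2) >= 1 + (m-2)/2 = m/2]. *)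
Lemma ler_powR2_B1 (R : realType) (m : R) : 2 <= m -> m <= 2 `^ (m - 1).
Proof.
move=> m2.
have h : expR (2^-1 : R) <= 2.
  have := expR_ge1Dx (- 2^-1 : R).
  rewrite expRN -[X in X <= _](_ : 2^-1 = _) ?lef_pV2 ?posrE ?expR_gt0 //.
  by lra.
rewrite (_ : m - 1 = 1 + (m - 2)); last by lra.
rewrite powRD ?pnatr_eq0 ?implybT // powRr1 //.
apply: (@le_trans _ _ (2 * (1 + (2^-1 * (m - 2))))); first by lra.
rewrite ler_pM2l //; apply: (le_trans (expR_ge1Dx _)); rewrite expRM.
by apply: ge0_ler_powR; rewrite ?nnegrE ?expR_ge0 //; lra.
Qed.

(* The value of [c] makes [M 2^(1-M) <= 1] absorb the factor [1/M] of the
   denominator, while [2 <= N] absorbs the remaining powers of [2] and [N]. *)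
Lemma lambda_bound_constant (R : realType) (P M Q phi psi lambda N D s c : R) :
  2 <= P -> 2 <= M -> 0 < Q -> 0 < phi -> 0 < psi -> 0 < lambda ->
  2 <= N -> 0 <= D <= N -> 1 <= s ->
  lambda < (Q / P * 2 `^ (- (P / 2)) * D `^ (P / 2) * N `^ (1 - P)
            * N `^ (- (P / 2))) / ((phi / M * N `^ (- (M / 2)) + psi) * s) ->
  c = 2^-1 * N `^ (- 2^-1) ->
  lambda * (phi * c `^ (M - 1) + psi) <= Q * c `^ (P - 1).
Proof.
move=> P2 M2 Q0 phi0 psi0 l0 N2 /andP[D0 DN] s1 hl c_def.
have N0 : 0 < N by lra.
have cE a : c `^ a = 2 `^ (- a) * N `^ (- (a / 2)).
  rewrite c_def powRM ?invr_ge0 ?powR_ge0 // -powRrM -powR_inv1 // -powRrM.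
  by congr (_ `^ _ * _ `^ _); lra.
set B := phi / M * _ + psi in hl.
have B0 : 0 < B by rewrite addr_gt0 // mulr_gt0 ?powR_gt0 // divr_gt0 //; lra.
have ND a b : N `^ (a + b) = N `^ a * N `^ b.
  by rewrite powRD // (gt_eqF N0) implybT.
have twoD a b : 2 `^ (a + b) = 2 `^ a * 2 `^ b :> R.
  by rewrite powRD // pnatr_eq0 implybT.
(* Here [c^(M-1) = 2^(1-M) N^(1/2) N^(-M/2)] with [2^(1-M) <= 1/M], and [psi] is only enlarged by
   [N^(1/2) >= 1]. *)
have step1 : phi * c `^ (M - 1) + psi <= N `^ 2^-1 * B.
  rewrite mulrDr; apply: lerD.
    rewrite cE (_ : - ((M - 1) / 2) = 2^-1 + - (M / 2)); last by lra.
    rewrite ND [leRHS](_ : _ = phi * (M^-1 * (N `^ 2^-1 * N `^ (- (M / 2)))));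
      last by ring.
    rewrite ler_pM2l // ler_wpM2r ?mulr_ge0 ?powR_ge0 //.
    rewrite powRN lef_pV2 ?posrE ?powR_gt0 //; last by lra.
    exact: ler_powR2_B1.
  rewrite ler_peMl ?(ltW psi0) // -[leLHS](powRr0 N); apply: ler_powR; lra.
(* The factors [1/s], [1/P] and [(D/N)^(P/2)] are all at most 1 and are dropped. *)
have step2 : lambda * B <= Q * 2 `^ (- (P / 2)) * N `^ (1 - P).
  apply: (@le_trans _ _ (lambda * (B * s))).
    by rewrite mulrA ler_peMr // mulr_ge0 // ltW.
  move: hl; rewrite ltr_pdivlMr ?mulr_gt0 //; last by lra.
  move=> /ltW /le_trans; apply.
  rewrite [leLHS](_ : _ = (P^-1 * (D `^ (P / 2) / N `^ (P / 2)))
    * (Q * 2 `^ (- (P / 2)) * N `^ (1 - P))); last by rewrite (powRN N); ring.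
  rewrite ler_piMl ?mulr_ge0 ?powR_ge0 ?(ltW Q0) //.
  rewrite mulr_ile1 ?divr_ge0 ?powR_ge0 ?invr_ge0 //; first by lra.
    by rewrite invf_le1; lra.
  rewrite ler_pdivrMr ?powR_gt0 // mul1r.
  by apply: ge0_ler_powR => //; rewrite ?nnegrE; lra.
apply: (@le_trans _ _ (N `^ 2^-1 * (Q * 2 `^ (- (P / 2)) * N `^ (1 - P)))).
  apply: (@le_trans _ _ (lambda * (N `^ 2^-1 * B))); first by rewrite ler_pM2l.
  by rewrite mulrCA ler_pM2l ?powR_gt0.
rewrite cE.
(* The exponents are split to show that the left side is [(2/N)^(P/2-1)] times the right side. *)
rewrite (_ : - (P / 2) = - (P - 1) + (P / 2 - 1)); last by lra.
rewrite twoD.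
rewrite (_ : 1 - P = - ((P - 1) / 2) + (- (P / 2 - 1) - 2^-1)); last by lra.
rewrite !ND !(powRN N (_ - _)) (powRN N 2^-1).
rewrite [leLHS](_ : _ = (2 `^ (P / 2 - 1) / N `^ (P / 2 - 1))
    * (Q * (2 `^ (- (P - 1)) * N `^ (- ((P - 1) / 2))))); last first.
  by field; rewrite !gt_eqF ?powR_gt0.
rewrite ler_piMl ?mulr_ge0 ?powR_ge0 ?(ltW Q0) //.
rewrite ler_pdivrMr ?powR_gt0 // mul1r.
by apply: ge0_ler_powR; rewrite ?nnegrE; lra.
Qed.

Theorem theorem11 (R : realType) (T : finType) (S dS : {set T})
    (edge : rel T) (w : T -> T -> R)
    (p q : T -> R) (f : T -> R -> R)
    (m1 m2 phi1 phi2 psi1 psi2 : T -> R)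
    (hG : weighted_graph S dS edge w)
    (hq : forall x, x \in S -> 0 < q x)
    (hp : forall x, 2 <= p x)
    (hf : forall x, x \in S -> continuous (f x))
    (hm1 : forall x, x \in S -> 2 <= m1 x)
    (hm2 : forall x, x \in S -> 2 <= m2 x)
    (hphi1 : forall x, x \in S -> 0 < phi1 x)
    (hphi2 : forall x, x \in S -> 0 < phi2 x)
    (hpsi1 : forall x, x \in S -> 0 < psi1 x)
    (hpsi2 : forall x, x \in S -> 0 < psi2 x)
    (hfl : forall x (t : R), x \in S -> 0 <= t ->
       psi1 x + phi1 x * t `^ (m1 x - 1) <= f x t)
    (hfu : forall x (t : R), x \in S -> 0 <= t ->
       f x t <= phi2 x * t `^ (m2 x - 1) + psi2 x)
    (hpm : min_on S p <> max_on S m1)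
    (lambda : R) (hlambda0 : 0 < lambda)
    (hlambda2 : lambda < lambda2 S dS p q m2 phi2 psi2) :
  exists u : T -> R, is_positive_solution S dS w p q f lambda u.
Proof.
have [S0 dS0 SdS _ _ _ _ w0 _ _] := hG.
have hp2 x : 0 <= p x - 2 by rewrite subr_ge0.
have [x0 x0S] := card_gt0P S0.
pose F x (u : T -> R) := - p_laplacian w p u x
  + q x * `|u x| `^ (p x - 2) * u x - lambda * f x (u x).
pose N : R := #|T|%:R.
pose c : R := 2^-1 * N `^ (- 2^-1).
have cardD : (#|S| + #|dS| <= #|T|)%N.
  by rewrite -cardsUI (disjoint_setI0 SdS) cards0 addn0 max_card.
have N2 : 2 <= N.
  by rewrite ler_nat; apply: leq_trans cardD; exact: (leq_add S0 dS0).
have c0 : 0 < c by rewrite mulr_gt0 ?invr_gt0 ?powR_gt0 //; lra.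
have c1 : c <= 1.
  rewrite mulr_ile1 ?powR_ge0 ?invr_ge0 //; first by lra.
  have hN : 0 < N by lra.
  rewrite powRN invf_le1 ?powR_gt0 //.
  by rewrite -[leLHS](powRr0 N) ler_powR //; lra.
have c01 : 0 < c <= 1 by rewrite c0.
(* As [0 < c <= 1], powers of [c] decrease in the exponent, so the worst case has the least [m2] and
   the greatest [p]. *)
have hc x : x \in S -> lambda * f x c <= q x * c `^ (p x - 1).
  move=> xS; have [x2 x2S m2E] := min_on_attained m2 S0.
  have [x3 x3S qE] := min_on_attained q S0.
  have phi_max := max_on_ge phi2 xS; have psi_max := max_on_ge psi2 xS.
  have p_max := max_on_ge p xS.
  have /= := @lambda_bound_constant R (max_on S p) (min_on S m2) (min_on S q)
    (max_on S phi2) (max_on S psi2) lambda N #|dS|%:R #|S|%:R c.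
  rewrite m2E => /(_ (le_trans (hp x) p_max) (hm2 _ x2S)) H.
  apply: le_trans (le_trans (H _ _ _ _ _ _ _ _ erefl) _) => //.
  - rewrite ler_pM2l //; apply: (le_trans (hfu x c xS (ltW c0))).
    apply: lerD => //; apply: ler_pM => //; first exact/ltW/hphi2.
      exact: powR_ge0.
    by apply: ger_powR => //; rewrite lerD2r -m2E; exact: min_on_le.
  - by rewrite qE; exact: hq.
  - exact: lt_le_trans (hphi2 x xS) phi_max.
  - exact: lt_le_trans (hpsi2 x xS) psi_max.
  - by rewrite ler0n /= ler_nat (leq_trans _ cardD) // leq_addl.
  - by rewrite ler1n.
  - by move: hlambda2; rewrite /lambda2 /= m2E.
  - apply: ler_pM; rewrite ?powR_ge0 ?(min_on_le q xS) //.
      by rewrite qE ltW // hq.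
    by apply: ger_powR => //; rewrite lerD2r.
have [||||u [Fu u0 uS]] := @Zsystem_solution R T S F c _ _ _ (ltW c0).
- move=> x u v xS uv uxv; rewrite /F -uxv lerD2r lerD2r lerN2.
  apply: ler_sum => y _; rewrite ler_wpM2r // -uxv.
  by apply: signed_powR_nondecreasing => //; rewrite lerD2r.
- move=> x u xS t; rewrite /F /p_laplacian eqxx /=.
  have hcont := @signed_powR_continuous R _ (hp2 x).
  apply: cvgB; last by apply: cvgMr; exact: hf.
  apply: cvgD; last first.
    under eq_fun do rewrite -mulrA.
    by rewrite -mulrA; apply: cvgMr; exact: hcont.
  apply: cvgN; move: t; apply: continuous_big => [|y _ t].
    exact: add_continuous.
  (* The term [y = x] is identically 0; in the others only [u y - t] varies. *)
  apply: cvgMl; case: eqP => _.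
    by under eq_fun do rewrite subrr mulr0; rewrite subrr mulr0; exact: cvg_cst.
  apply: (@continuous_comp _ _ _ (fun s => u y - s)
    (fun s => `|s| `^ (p x - 2) * s) t); last exact: hcont.
  by apply: cvgB; [exact: cvg_cst|exact: cvg_id].
(* At a zero of [u >= 0] the Laplacian is nonnegative, while [f x 0 >= psi1 x > 0]. *)
- move=> x u xS u0 ux0; rewrite /F ux0 mulr0 addr0 subr_lt0.
  apply: (@le_lt_trans _ _ 0).
    rewrite oppr_le0; apply: sumr_ge0 => y _.
    by rewrite ux0 subr0 !mulr_ge0 ?powR_ge0.
  rewrite mulr_gt0 //; apply: lt_le_trans (hfl x 0 xS (lexx 0)).
  by rewrite ltr_wpDr ?hpsi1 // mulr_ge0 ?powR_ge0 // ltW ?hphi1.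
(* For the constant [c] on [S], interior neighbours contribute 0 and boundary ones make minus the
   Laplacian nonnegative, so the zero-order term suffices. *)
- move=> x xS; rewrite /F xS subr_ge0; apply: (le_trans (hc x xS)).
  rewrite ler_wpDl //.
    rewrite oppr_ge0; apply: sumr_le0 => y _; rewrite xS.
    apply: mulr_le0_ge0 => //; apply: mulr_ge0_le0; first exact: powR_ge0.
    by case: ifP; rewrite ?subrr // sub0r oppr_le0 ltW.
  rewrite (gtr0_norm c0) -mulrA ler_pM2l ?hq //.
  rewrite mulrC (_ : p x - 2 = p x - 1 - 1) ?mulr_powRB1 //; first exact: ltW.
    by have := hp x; lra.
  by lra.
exists u; split=> //; split=> x xS; last first.
  by apply: uS; rewrite (disjointFl SdS).
by apply/eqP; rewrite -subr_eq0; apply/eqP; exact: Fu.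
Qed.
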